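(* Let $n\geq1$ and $r\geq3$. Then $$\det(1;T_r^{(r)},T_{r+2}^{(r)},\ldots,T_{2n+r-2}^{(r)})=\begin{cases}(-1)^{n-1}k_n^{(r)}, & \text{if } r\text{ is odd};\\ (-1)^{n-1}\displaystyle\sum_{i=0}^{n-1}a_i^{(r/2)}a_{n-1-i}^{(r/2)}, & \text{if } r \text{ is even},\end{cases}$$ where the numbers $k_n^{(r)}$ are defined by $$\sum_{n\geq1}k_n^{(r)}x^n=\frac{x+x^{\frac{r+1}{2}}}{1-2x+x^2-x^{\frac{r+1}{2}}-x^r}.$$ In particular, for $r=3$, $$\det(1;T_3,T_5,\ldots,T_{2n+1})=(-2)^{n-1}\sum_{i=0}^{n-1}2^{-i-\lfloor i/2\rfloor}\binom{n-1-i}{\lfloor i/2\rfloor}.$$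
   Context: For $r\ge3$, the generalized $r$-tribonacci numbers are defined by $T_0^{(r)}=\cdots=T_{r-2}^{(r)}=0$, $T_{r-1}^{(r)}=1$, and $T_n^{(r)}=T_{n-1}^{(r)}+T_{n-2}^{(r)}+T_{n-r}^{(r)}$ for $n\geq r$; $T_n=T_n^{(3)}$ are the ordinary tribonacci numbers ($T_0=T_1=0$, $T_2=1$, $T_n=T_{n-1}+T_{n-2}+T_{n-3}$). For an integer $m\ge2$, $a_0^{(m)}=\cdots=a_{m-1}^{(m)}=1$ and $a_n^{(m)}=a_{n-1}^{(m)}+a_{n-m}^{(m)}$ for $n\ge m$. For numbers $a_0,\ldots,a_n$, $\det(a_0;a_1,\ldots,a_n)$ denotes the determinant of the $n\times n$ Toeplitz--Hessenberg matrix whose $(i,j)$ entry is $a_{i-j+1}$ if $i-j+1\ge0$ and $0$ otherwise; here the $k$-th entry after the semicolon is $T_{r+2k-2}^{(r)}$. *)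

(* Defs.v *)
From mathcomp Require Import all_boot all_order all_algebra.
Set Implicit Arguments.
Unset Strict Implicit.
Unset Printing Implicit Defensive.
Import Order.TTheory GRing.Theory Num.Theory.
Local Open Scope ring_scope.

(* Course-of-values recursion: [covrec step n] is obtained by applying [step] *)
(* to the list [:: u 0; ...; u n.-1] of all previous values of the sequence,  *)
(* so that inside [step] the current index is the size of the list.           *)
Fixpoint covhist (A : Type) (step : seq A -> A) (n : nat) : seq A :=
  if n is n'.+1 then rcons (covhist step n') (step (covhist step n'))
  else [::].

Definition covrec (A : Type) (step : seq A -> A) (n : nat) : A :=
  step (covhist step n).

Lemma covhistE (A : Type) (step : seq A -> A) n :
  covhist step n = mkseq (covrec step) n.
Proof. by elim: n => [|n IHn] //=; rewrite /mkseq -addn1 iotaD map_cat cats1 -/(mkseq _ _) -IHn. Qed.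

Lemma covrecE (A : Type) (step : seq A -> A) n :
  covrec step n = step (mkseq (covrec step) n).
Proof. by rewrite -covhistE. Qed.

Definition trib (r : nat) : nat -> nat :=
  covrec (fun s => let n := size s in
    if (n < r.-1)%N then 0%N
    else if n == r.-1 then 1%N
    else (nth 0 s (n - 1) + nth 0 s (n - 2) + nth 0 s (n - r))%N).

Definition narayana (m : nat) : nat -> nat :=
  covrec (fun s => let n := size s in
    if (n < m)%N then 1%N
    else (nth 0 s (n - 1) + nth 0 s (n - m))%N).

Lemma trib_small r n : (n < r.-1)%N -> trib r n = 0%N.
Proof. by move=> h; rewrite /trib covrecE size_mkseq h. Qed.

Lemma trib_pred r : trib r r.-1 = 1%N.
Proof. by rewrite /trib covrecE size_mkseq ltnn eqxx. Qed.

Lemma trib_rec r n : (2 < r)%N -> (r <= n)%N ->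
  trib r n = (trib r (n - 1) + trib r (n - 2) + trib r (n - r))%N.
Proof.
move=> r3 rn; have r1 : (r.-1 < n)%N by case: r r3 rn.
rewrite {1}/trib covrecE size_mkseq ltnNge (ltnW r1) /= gtn_eqF //.
have n0 : (0 < n)%N by exact: leq_ltn_trans r1.
have r0 : (0 < r)%N by exact: ltn_trans r3.
by rewrite !nth_mkseq // ltn_subrL n0 ?r0.
Qed.

Lemma narayana_small m n : (n < m)%N -> narayana m n = 1%N.
Proof. by move=> h; rewrite /narayana covrecE size_mkseq h. Qed.

Lemma narayana_rec m n : (1 < m)%N -> (m <= n)%N ->
  narayana m n = (narayana m (n - 1) + narayana m (n - m))%N.
Proof.
move=> m2 mn; rewrite {1}/narayana covrecE size_mkseq ltnNge mn /=.
have m0 : (0 < m)%N by exact: ltn_trans m2.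
have n0 : (0 < n)%N by exact: leq_trans mn.
by rewrite !nth_mkseq // ltn_subrL n0 ?m0.
Qed.

(* The matrix depends only on a 0, ..., a n.                                  *)
Definition toeplitz_hessenberg (R : comNzRingType) (a : nat -> R) (n : nat) :
    'M[R]_n :=
  \matrix_(i < n, j < n) if (j <= i.+1)%N then a (i.+1 - j)%N else 0.

(* [th_det a0 b n] is det(a0; b 1, ..., b n); the value b 0 is not used.      *)
Definition th_det (R : comNzRingType) (a0 : R) (b : nat -> R) (n : nat) : R :=
  \det (toeplitz_hessenberg (fun k => if k is 0 then a0 else b k) n).

(* Formal power series are represented by their coefficient sequences; the    *)
(* quotient f / g is meaningful when g 0 is a unit, see [fps_divK].           *)
Definition fps_mul (R : comNzRingType) (f g : nat -> R) (n : nat) : R :=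
  \sum_(i < n.+1) f i * g (n - i)%N.

Definition fps_div (R : comUnitRingType) (f g : nat -> R) : nat -> R :=
  covrec (fun s => let n := size s in
    (f n - \sum_(i < n) s`_i * g (n - i)%N) / g 0%N).

Lemma fps_divK (R : comUnitRingType) (f g : nat -> R) :
  g 0%N \is a GRing.unit -> fps_mul (fps_div f g) g =1 f.
Proof.
move=> gu n; rewrite /fps_mul big_ord_recr /= subnn.
rewrite {2}/fps_div covrecE size_mkseq divrK // addrCA -[RHS]addr0.
congr (_ + _); apply/eqP; rewrite subr_eq0; apply/eqP.
by apply: eq_bigr => i _; rewrite nth_mkseq.
Qed.

Definition knum (r : nat) : {poly int} := 'X + 'X^(r.+1./2).

Definition kden (r : nat) : {poly int} :=
  1 - 'X *+ 2 + 'X^2 - 'X^(r.+1./2) - 'X^r.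

Definition knumber (r : nat) : nat -> int :=
  fps_div (fun n => (knum r)`_n) (fun n => (kden r)`_n).

Lemma kden0 r : (2 < r)%N -> (kden r)`_0 = 1.
Proof. by case: r => [|[|[|r]]] // _; rewrite /kden !coefE. Qed.

Lemma knumber0 r : (2 < r)%N -> knumber r 0 = 0.
Proof.
case: r => [|[|[|r]]] // _; rewrite /knumber /fps_div covrecE /= big_ord0.
by rewrite /knum !coefE subr0 addr0 mul0r.
Qed.

(* The series starts at x^1.                                                  *)
Lemma knumber_genfun r : (2 < r)%N ->
  fps_mul (fun n => if n is 0 then 0 else knumber r n)
    (fun n => (kden r)`_n) =1 (fun n => (knum r)`_n).
Proof.
move=> r3 n.
transitivity (fps_mul (knumber r) (fun n => (kden r)`_n) n); last first.
  by apply: fps_divK; rewrite kden0.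
by apply: eq_bigr => [[[|i] hi]] _ //=; rewrite knumber0.
Qed.

(* Main.v *)
Require Import Defs.
From mathcomp Require Import all_boot all_order all_algebra.
From mathcomp Require Import ring zify.
Import Order.TTheory GRing.Theory Num.Theory.
Local Open Scope ring_scope.

(* If [B] is the generating function of the entries b_1, b_2, ... then the    *)
(* determinants D_n satisfy [sum (-1)^n D_n x^n = 1 / (1 + B)], so the claim  *)
(* [D_n = (-1)^(n-1) c_n] for n >= 1 amounts to [(1 + B) (1 - C) = 1], where  *)
(* [C = p / d] is the claimed generating function; that is [B (d - p) = p].   *)
(* Splitting the r-tribonacci recurrence according to the parity of the index *)
(* and eliminating the other half yields exactly this equation for [B], with  *)
(* [p = x + x^((r+1)/2)] for odd r, and [p = x], [d = (1 - x - x^(r/2))^2]    *)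
(* for even r.  Power series identities are read off polynomials truncated    *)
(* modulo ['X^N].                                                             *)

(** The passage from determinants to series is [th_det_quotient], resting on [th_det_inverse]. The
    arithmetic input is [trib_bisection_odd] and [trib_bisection_even]: the term T_{n-r} switches
    the parity of the index when r is odd and preserves it when r is even, hence the two kinds of
    denominator. For even r one has C = x A^2, where A = 1 / (1 - x - x^(r/2)) is the series of the
    numbers [narayana (r/2)], so the coefficients of C are convolution sums. For r = 3 the
    denominator of C collapses to 1 - 2x - x^3, and [knumber3_binom] checks that 2^m times the
    binomial sum obeys the resulting recurrence with the same initial values. *)

Definition eqmodX {R : comNzRingType} (N : nat) (p q : {poly R}) : Prop :=
  exists s, p = q + s * 'X^N.

Lemma eqmodXP (R : comNzRingType) (N : nat) (p q : {poly R}) :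
  eqmodX N p q <-> (forall i, (i < N)%N -> p`_i = q`_i).
Proof.
split=> [[s ->] i iN|H]; first by rewrite coefD coefMXn iN addr0.
exists (drop_poly N (p - q)); apply/eqP; rewrite -subr_eq0 opprD addrA.
rewrite -{1}(poly_take_drop N (p - q)) addrK; apply/eqP/polyP => i.
rewrite coef_take_poly coef0 coefB.
by case: ifP => // /H ->; rewrite subrr.
Qed.

(** The top term of the i-th convolution is the unknown coefficient times 1 and the lower terms
    agree by induction, so [u] can be cancelled without constructing its inverse series. *)
Lemma eqmodX_cancel (R : comNzRingType) (N : nat) (p q u : {poly R}) :
  u`_0 = 1 -> eqmodX N (p * u) (q * u) -> eqmodX N p q.
Proof.
move=> u0 /eqmodXP H; apply/eqmodXP => i.
elim/ltn_ind: i => i IH iN; have := H i iN.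
rewrite !coefM !big_ord_recr /= subnn u0 !mulr1.
rewrite (eq_bigr (fun j : 'I_i => q`_j * u`_(i - j))) => [|j _].
  exact: addrI.
by rewrite IH // (ltn_trans (ltn_ord j)).
Qed.

Lemma coef_polyM_fps (R : comNzRingType) (N : nat) (f : nat -> R)
    (q : {poly R}) i :
  (i < N)%N ->
  (\poly_(j < N) f j * q)`_i = fps_mul f (fun j => q`_j) i.
Proof.
move=> iN; rewrite coefM; apply: eq_bigr => j _; rewrite coef_poly.
by rewrite (leq_ltn_trans _ iN) // -ltnS.
Qed.

(** * Hessenberg determinants as coefficients of reciprocal series *)

(* Deleting the first row and the last column of the unitriangular Toeplitz   *)
(* matrix [L] leaves the Toeplitz-Hessenberg matrix, so its determinant is up *)
(* to sign an entry of the adjugate of [L], i.e. of the inverse of [L].       *)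
Lemma th_det_inverse (R : comNzRingType) (b e : nat -> R) (n : nat) :
  (forall k, (k <= n)%N ->
     fps_mul e (fun j => if j is 0 then 1 else b j) k = (k == 0%N)%:R) ->
  th_det 1 b n = (-1) ^+ n * e n.
Proof.
move=> He; set a := fun j => if j is 0 then 1 else b j.
pose L : 'M[R]_n.+1 := \matrix_(i, j) if (j <= i)%N then a (i - j)%N else 0.
pose v : 'cV[R]_n.+1 := \col_i e i.
have detL : \det L = 1.
  rewrite det_trig; last first.
    by apply/is_trig_mxP => i j ij; rewrite mxE leqNgt ij.
  by apply: big1 => i _; rewrite mxE leqnn subnn.
have Lv : L *m v = delta_mx 0 0.
  apply/matrixP => i j; rewrite !mxE ord1 eqxx andbT.
  rewrite -[i == 0]/(i == 0%N :> nat) -He -1?ltnS //.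
  rewrite /fps_mul (bigID (fun k : 'I_n.+1 => (k <= i)%N)) /= addrC big1 ?add0r.
    rewrite (big_ord_widen_cond n.+1 predT (fun k => e k * a (i - k)%N)) //=.
    by apply: eq_big => k; rewrite ?ltnS // => ki; rewrite !mxE ki mulrC.
  by move=> k /negbTE ki; rewrite mxE ki mul0r.
(* Since [\det L = 1], [v] is the first column of [\adj L]; its last entry [e n] is the cofactor of
   [L] at the first row and last column. *)
have : \adj L *m (L *m v) = v by rewrite mulmxA mul_adj_mx detL mul1mx.
rewrite Lv => /matrixP /(_ ord_max 0); rewrite !mxE.
rewrite (bigD1 0) //= !mxE !eqxx mulr1 big1 ?addr0 => [<-|i /negbTE i0]; last first.
  by rewrite !mxE i0 mulr0.
rewrite /cofactor add0n mulrA -exprD addnn -signr_odd odd_double mul1r.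
congr (\det _); apply/matrixP => i j; rewrite !mxE /=.
by rewrite /bump leq0n add1n [(n <= j)%N]leqNgt ltn_ord.
Qed.

(** With e = 1 - c, modulo the truncation (d - C d) ((d - p) + B (d - p)) becomes (d - p) d, and
    cancelling d (d - p), of constant term 1, shows that e inverts 1 + B. For n > 0, [e n = - c n]
    accounts for the exponent n - 1. *)
Lemma th_det_quotient (R : comNzRingType) (b c : nat -> R) (p d : {poly R})
    (n : nat) :
  (0 < n)%N -> b 0%N = 0 -> p`_0 = 0 -> d`_0 = 1 ->
  eqmodX n.+1 (\poly_(i < n.+1) b i * (d - p)) p ->
  eqmodX n.+1 (\poly_(i < n.+1) c i * d) p ->
  th_det 1 b n = (-1) ^+ (n - 1) * c n.
Proof.
move=> n0 b0 p0 d0 [s Hb] [t Hc].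
pose e k := (if k is 0 then 1 else 0) - c k.
rewrite (th_det_inverse R b e n) => [|k kn]; last first.
  rewrite -[fps_mul _ _ _]/(fps_mul e (fun j => if j is 0 then 1 else b j) k).
  have -> : (k == 0%N)%:R = (1 : {poly R})`_k by rewrite coef1.
  transitivity ((\poly_(j < n.+1) e j * (1 + \poly_(i < n.+1) b i))`_k).
    rewrite coef_polyM_fps //; apply: eq_bigr => i _; congr (_ * _).
    rewrite coefD coef1 coef_poly (leq_ltn_trans (leq_subr _ _)) //.
    by case: (k - i)%N => [|j]; rewrite ?b0 ?addr0 ?add0r.
  have -> : \poly_(j < n.+1) e j = 1 - \poly_(j < n.+1) c j.
    apply/polyP => i; rewrite coefB coef1 !coef_poly.
    by case: ifP => [_|]; case: i => //= *; rewrite subr0.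
  apply: (proj1 (eqmodXP R n.+1 _ _)) (kn).
  apply: (@eqmodX_cancel _ _ _ _ (d * (d - p))).
    by rewrite coef0M coefB d0 p0 subr0 mulr1.
  (* The error terms of ((d - p) - t X^(n+1)) (d + s X^(n+1)). *)
  exists (s * (d - p) - t * d - t * s * 'X^(n.+1)).
  have -> : (1 - \poly_(j < n.+1) c j) * (1 + \poly_(i < n.+1) b i) * (d * (d - p))
    = (d - \poly_(j < n.+1) c j * d) * ((d - p) + \poly_(i < n.+1) b i * (d - p)).
    by ring.
  by rewrite Hb Hc; ring.
case: n n0 {Hb Hc} => // n _; rewrite /e subn1 /= sub0r exprS; ring.
Qed.

(** * Bisection of the r-tribonacci sequence *)

Lemma coef_exp_polyM (R : comNzRingType) (N m k : nat) (f : nat -> R) :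
  (k < N)%N ->
  ('X^m * \poly_(i < N) f i)`_k = if (k < m)%N then 0 else f (k - m)%N.
Proof.
by move=> kN; rewrite coefXnM coef_poly (leq_ltn_trans (leq_subr _ _) kN).
Qed.

Lemma trib_step_even (r i : nat) : (2 < r)%N ->
  trib r (r + 2 * i.+1 - 1) =
  (trib r (r + 2 * i.+1 - 2) + trib r (r + 2 * i - 1) + trib r (2 * i).+1)%N.
Proof.
move=> r3; rewrite trib_rec //; last lia.
by congr (trib r _ + trib r _ + trib r _)%N; lia.
Qed.

Lemma trib_step_odd (r i : nat) : (2 < r)%N ->
  trib r (r + 2 * i.+1 - 2) =
  (trib r (r + 2 * i - 1) + trib r (r + 2 * i - 2) + trib r (2 * i))%N.
Proof.
move=> r3; rewrite trib_rec //; last lia.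
by congr (trib r _ + trib r _ + trib r _)%N; lia.
Qed.

(** With E the series of the other parity class, the recurrence reads (1 - x) E = 1 + (1 + x^(h-1))
    B and (1 - x) B = x (1 + x^(h-1)) E; the constant 1 is T_{r-1}. Eliminating E gives the
    equation. *)
Lemma trib_bisection_odd (N h : nat) : (1 < h)%N ->
  let r := (2 * h - 1)%N in
  let B : {poly int} := \poly_(i < N) (trib r (r + 2 * i - 2))%:Z in
  eqmodX N (B * ((1 - 'X) ^+ 2 - 'X * (1 + 'X^(h - 1)) ^+ 2)) ('X + 'X^h).
Proof.
move=> h1 r B; have r3 : (2 < r)%N by rewrite /r; lia.
pose E : {poly int} := \poly_(i < N) (trib r (r + 2 * i - 1))%:Z.
have Xh : 'X^h = 'X * 'X^(h - 1) :> {poly int}.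
  by rewrite -exprS; congr (_ ^+ _); lia.
have [s Hs] : eqmodX N E (1 + B + 'X^1 * E + 'X^(h - 1) * B).
  apply: (proj2 (eqmodXP _ _ _ _)) => i iN; rewrite !coefD coef1 !coef_exp_polyM // !coef_poly iN.
  case: i iN => [|i] iN /=.
    rewrite subn_gt0 h1 !muln0 !addn0 !addr0 subn1 trib_pred.
    by rewrite trib_small //; lia.
  rewrite trib_step_even // !PoszD add0r; congr (_ + _ + _); first by rewrite subSS subn0.
  (* Below the shift [h - 1] the index 2i + 1 is less than r - 1, where the sequence vanishes, in
     agreement with the zero coefficients of the shifted series. *)
  case: (ltnP i.+1 (h - 1)) => ih; first by rewrite trib_small //; rewrite /r; lia.
  by congr (trib r _)%:Z; rewrite /r; lia.
have [t Ht] : eqmodX N B ('X^1 * E + 'X^1 * B + 'X^h * E).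
  apply: (proj2 (eqmodXP _ _ _ _)) => i iN; rewrite !coefD !coef_exp_polyM // !coef_poly iN.
  case: i iN => [|i] iN /=.
    by rewrite (ltnW h1) !addr0 trib_small //; lia.
  rewrite trib_step_odd // !PoszD; congr (_ + _ + _); rewrite ?subSS ?subn0 //.
  case: (ltnP i.+1 h) => ih; first by rewrite trib_small //; rewrite /r; lia.
  by congr (trib r _)%:Z; rewrite /r; lia.
(* The errors [t] and [s] weighted by the multipliers that eliminate [E]. *)
exists (t * (1 - 'X) + s * 'X * (1 + 'X^(h - 1))).
rewrite expr1 in Hs Ht.
suff : (1 - 'X) * (B - ('X * E + 'X * B + 'X^h * E + t * 'X^N)) +
  'X * (1 + 'X^(h - 1)) * (E - (1 + B + 'X * E + 'X^(h - 1) * B + s * 'X^N)) = 0.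
  by move=> H; apply/eqP; rewrite -subr_eq0 -H; apply/eqP; rewrite Xh; ring.
by rewrite -Hs -Ht !subrr !mulr0 addr0.
Qed.

(** Here T_{n-r} stays in its parity class, so the system is (1 - x - x^m) E = 1 + B and (1 - x -
    x^m) B = x E. *)
Lemma trib_bisection_even (N m : nat) : (1 < m)%N ->
  let r := (2 * m)%N in
  let B : {poly int} := \poly_(i < N) (trib r (r + 2 * i - 2))%:Z in
  eqmodX N (B * ((1 - 'X - 'X^m) ^+ 2 - 'X)) 'X.
Proof.
move=> m1 r B; have r3 : (2 < r)%N by rewrite /r; lia.
pose E : {poly int} := \poly_(i < N) (trib r (r + 2 * i - 1))%:Z.
have [s Hs] : eqmodX N E (1 + B + 'X^1 * E + 'X^m * E).
  apply: (proj2 (eqmodXP _ _ _ _)) => i iN; rewrite !coefD coef1 !coef_exp_polyM // !coef_poly iN.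
  case: i iN => [|i] iN /=.
    rewrite (ltnW m1) !muln0 !addn0 !addr0 subn1 trib_pred.
    by rewrite trib_small //; lia.
  rewrite trib_step_even // !PoszD add0r; congr (_ + _ + _); first by rewrite subSS subn0.
  case: (ltnP i.+1 m) => im; first by rewrite trib_small //; rewrite /r; lia.
  by congr (trib r _)%:Z; rewrite /r; lia.
have [t Ht] : eqmodX N B ('X^1 * E + 'X^1 * B + 'X^m * B).
  apply: (proj2 (eqmodXP _ _ _ _)) => i iN; rewrite !coefD !coef_exp_polyM // !coef_poly iN.
  case: i iN => [|i] iN /=.
    by rewrite (ltnW m1) !addr0 trib_small //; lia.
  rewrite trib_step_odd // !PoszD; congr (_ + _ + _); rewrite ?subSS ?subn0 //.
  case: (ltnP i.+1 m) => im; first by rewrite trib_small //; rewrite /r; lia.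
  by congr (trib r _)%:Z; rewrite /r; lia.
exists (t * (1 - 'X - 'X^m) + s * 'X); rewrite expr1 in Hs Ht.
suff : (1 - 'X - 'X^m) * (B - ('X * E + 'X * B + 'X^m * B + t * 'X^N)) +
  'X * (E - (1 + B + 'X * E + 'X^m * E + s * 'X^N)) = 0.
  by move=> H; apply/eqP; rewrite -subr_eq0 -H; apply/eqP; ring.
by rewrite -Hs -Ht !subrr !mulr0 addr0.
Qed.

(** * Generating functions of the claimed values *)

Lemma narayana_genfun (N m : nat) : (1 < m)%N ->
  eqmodX N (\poly_(i < N) (narayana m i)%:Z * (1 - 'X - 'X^m)) 1.
Proof.
move=> m1; set A : {poly int} := \poly_(i < N) _.
have [s Hs] : eqmodX N A (1 + 'X^1 * A + 'X^m * A).
  apply: (proj2 (eqmodXP _ _ _ _)) => i iN; rewrite !coefD coef1 !coef_exp_polyM // coef_poly iN.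
  case: i iN => [|i] iN /=.
    by rewrite narayana_small ?(ltnW m1) // !addr0.
  rewrite add0r subn1 /=; case: ltnP => im.
    by rewrite !narayana_small ?addr0 //; lia.
  by rewrite narayana_rec // PoszD subn1.
exists s; rewrite expr1 in Hs; apply/eqP; rewrite -subr_eq0.
have -> : A * (1 - 'X - 'X^m) - (1 + s * 'X^N)
  = A - (1 + 'X * A + 'X^m * A + s * 'X^N) by ring.
by rewrite -Hs subrr.
Qed.

Lemma narayana_conv_genfun (N m : nat) : (1 < m)%N ->
  eqmodX N (\poly_(n < N) (\sum_(0 <= i < n)
     (narayana m i)%:Z * (narayana m (n - 1 - i))%:Z)
   * (1 - 'X - 'X^m) ^+ 2) 'X.
Proof.
move=> m1; have [s Hs] := narayana_genfun N m m1.
set A : {poly int} := \poly_(i < N) _ in Hs.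
have [t ->] : eqmodX N (\poly_(n < N) (\sum_(0 <= i < n)
     (narayana m i)%:Z * (narayana m (n - 1 - i))%:Z)) ('X * (A * A)).
  apply: (proj2 (eqmodXP _ _ _ _)) => -[|n] nN; rewrite coef_poly nN coefXM //=.
    by rewrite big_geq.
  rewrite coef_polyM_fps 1?ltnW // big_mkord; apply: eq_bigr => i _.
  by rewrite subn1 coef_poly (leq_ltn_trans (leq_subr _ _)) // ltnW.
set u := 1 - 'X - 'X^m in Hs *.
exists ('X * (s + s + s * s * 'X^N) + t * u ^+ 2).
have -> : ('X * (A * A) + t * 'X^N) * u ^+ 2
  = 'X * ((A * u) * (A * u)) + t * u ^+ 2 * 'X^N by ring.
by rewrite Hs; ring.
Qed.

Lemma knumber_polyM (N r : nat) : (2 < r)%N ->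
  eqmodX N (\poly_(i < N) knumber r i * kden r) (knum r).
Proof.
move=> r3; apply: (proj2 (eqmodXP _ _ _ _)) => i iN; rewrite coef_polyM_fps //.
by apply: fps_divK; rewrite kden0.
Qed.

(** * The two parities of r *)

Lemma th_det_trib_odd (n h : nat) : (0 < n)%N -> (1 < h)%N ->
  let r := (2 * h - 1)%N in
  th_det 1 (fun k => (trib r (r + 2 * k - 2))%:Z) n
  = (-1) ^+ (n - 1) * knumber r n.
Proof.
move=> n0 h1 r; have r3 : (2 < r)%N by rewrite /r; lia.
have rh : (r.+1./2 = h)%N by rewrite /r; lia.
apply: (th_det_quotient _ _ _ (knum r) (kden r)) => //.
- by rewrite trib_small //; lia.
- by rewrite /knum rh coefD coefX coefXn; case: h h1 {r r3 rh}.
- exact: kden0.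
- have := trib_bisection_odd n.+1 h h1; rewrite -/r.
  suff -> : kden r - knum r = (1 - 'X) ^+ 2 - 'X * (1 + 'X^(h - 1)) ^+ 2.
    by rewrite /knum rh.
  have Xh : 'X^h = 'X * 'X^(h - 1) :> {poly int}.
    by rewrite -exprS; congr (_ ^+ _); lia.
  have Xr : 'X^r = 'X * ('X^(h - 1) * 'X^(h - 1)) :> {poly int}.
    by rewrite -exprD -exprS; congr (_ ^+ _); rewrite /r; lia.
  by rewrite /kden /knum rh Xr Xh; ring.
- exact: knumber_polyM.
Qed.

Lemma th_det_trib_even (n m : nat) : (0 < n)%N -> (1 < m)%N ->
  let r := (2 * m)%N in
  th_det 1 (fun k => (trib r (r + 2 * k - 2))%:Z) n
  = (-1) ^+ (n - 1) * \sum_(0 <= i < n)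
      (narayana m i)%:Z * (narayana m (n - 1 - i))%:Z.
Proof.
move=> n0 m1 r.
apply: (th_det_quotient _ _ (fun n => \sum_(0 <= i < n)
      (narayana m i)%:Z * (narayana m (n - 1 - i))%:Z) 'X
  ((1 - 'X - 'X^m) ^+ 2)) => //.
- by rewrite trib_small // /r; lia.
- by rewrite coefX.
- by rewrite coef0M !coefB coefX coefXn coef1; case: m m1 {r}.
- exact: trib_bisection_even.
- exact: narayana_conv_genfun.
Qed.

(** * The binomial formula for r = 3 *)

Lemma knumber3_coef n :
  knumber 3 n = 2 * (if n is i.+1 then knumber 3 i else 0)
    + (if n is i.+3 then knumber 3 i else 0) + (n == 1%N)%:R + (n == 2)%:R.
Proof.
(* Since (r + 1)/2 = 2, the two quadratic terms cancel. *)
have kden3 : kden 3 = 1 - 'X *+ 2 - 'X^3 by rewrite /kden /=; ring.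
have := proj1 (eqmodXP _ _ _ _) (knumber_polyM n.+1 3 isT) n (ltnSn n).
rewrite kden3 /knum coefD coefX coefXn !mulrBr mulr1 mulrnAr.
rewrite !coefB coefMn coefMX coefMXn !coef_poly ltnSn.
by case: n => [|[|[|n]]]; rewrite ?subSS ?subn0 /=; do ?case: ifP; lia.
Qed.

Definition trib_binom_sum (m : nat) : rat :=
  \sum_(0 <= i < m.+1) 2 ^- (i + i %/ 2) * ('C(m - i, i %/ 2))%:R.

(** Pascal's rule splits the sum; in the second half the shift i -> i + 2 raises i/2 by one and the
    exponent of 2 by three, whence the factor 1/8. This is k_{m+4} = 2 k_{m+3} + k_{m+1} after
    division by 2^(m+3). *)
Lemma trib_binom_sum_rec m :
  trib_binom_sum m.+3 = trib_binom_sum m.+2 + trib_binom_sum m / 8.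
Proof.
rewrite /trib_binom_sum big_nat_recr //= subnn bin0n.
have -> : (m.+3 %/ 2 == 0)%N = false by lia.
rewrite mulr0 addr0.
transitivity (\sum_(0 <= i < m.+3) (2 ^- (i + i %/ 2) * ('C(m.+2 - i, i %/ 2))%:R
   + 2 ^- (i + i %/ 2) *
     (if (i %/ 2)%N is j.+1 then 'C(m.+2 - i, j) else 0%N)%:R) : rat).
  apply: eq_big_nat => i /andP [_ im]; rewrite -mulrDr -natrD subSn //.
  by congr (_ * _%:R); case: (i %/ 2)%N => [|j]; rewrite ?bin0 // binS.
rewrite big_split /=; congr (_ + _).
(* The terms i = 0 and i = 1 vanish, because there [i %/ 2] is 0. *)
rewrite big_nat_recl // big_nat_recl //= !mulr0 !add0r mulr_suml.
apply: eq_big_nat => i im.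
have -> : (i.+2 %/ 2 = (i %/ 2).+1)%N by lia.
have -> : (i.+2 + (i %/ 2).+1 = i + i %/ 2 + 3)%N by lia.
by rewrite exprD invfM !subSS /= mulrAC; congr (_ / _); ring.
Qed.

Lemma knumber3_binom m : (knumber 3 m.+1)%:~R = 2 ^+ m * trib_binom_sum m.
Proof.
have k1 : knumber 3 1 = 1 by rewrite knumber3_coef knumber0.
have k2 : knumber 3 2 = 3 by rewrite knumber3_coef k1.
elim/ltn_ind: m => -[|[|[|m]]] IH.
- by rewrite k1 /trib_binom_sum unlock.
- by rewrite k2 /trib_binom_sum !big_nat_recr //= big_geq.
- rewrite knumber3_coef /= k2 knumber0 //.
  by rewrite /trib_binom_sum !big_nat_recr //= big_geq.
rewrite knumber3_coef /= !addr0 rmorphD rmorphM /= !IH //; last by lia.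
by rewrite trib_binom_sum_rec !exprS; field.
Qed.

Theorem theorem8 (n : nat) (hn : (1 <= n)%N) :
  (forall r : nat, (3 <= r)%N ->
     th_det 1 (fun k => (trib r (r + 2 * k - 2))%:Z) n =
     if odd r then (-1) ^+ (n - 1) * knumber r n
     else (-1) ^+ (n - 1) *
          \sum_(0 <= i < n)
            (narayana (r %/ 2) i)%:Z * (narayana (r %/ 2) (n - 1 - i))%:Z) /\
  (th_det 1 (fun k => (trib 3 (2 * k + 1))%:Z) n)%:~R =
    (- 2) ^+ (n - 1) *
    \sum_(0 <= i < n)
      2 ^- (i + i %/ 2) * ('C(n - 1 - i, i %/ 2))%:R :> rat.
Proof.
split=> [r r3|].
  case: ifP => ro.
    have -> : r = (2 * r.+1./2 - 1)%N by lia.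
    by apply: th_det_trib_odd => //; lia.
  have {1 2}-> : r = (2 * (r %/ 2))%N by lia.
  by apply: th_det_trib_even => //; lia.
have -> : th_det 1 (fun k => (trib 3 (2 * k + 1))%:Z) n
  = th_det 1 (fun k => (trib 3 (3 + 2 * k - 2))%:Z) n.
  congr (\det _); apply/matrixP => i j; rewrite !mxE.
  by case: (_ <= _)%N => //; case: (i.+1 - j)%N => // k; congr (trib 3 _)%:Z; lia.
rewrite (th_det_trib_odd n 2) //.
case: n hn => // n _; rewrite subn1 /= rmorphM rmorphXn /= rmorphN1 knumber3_binom.
by rewrite mulrA -exprMn mulN1r.
Qed.
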